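(* Let $X$ be a real Banach space with dual $X^{\ast}$ and let $T:X\rightrightarrows X^{\ast}$ be a set-valued operator. There exists a lower semicontinuous proper sublinear functional $s:X\rightarrow\mathbb{R}\cup\{+\infty\}$ such that $T=\partial s$ if and only if $T$ is maximally monotone and $\mathrm{range}\,T=T(0_{X})$.
   Context: Let $\langle x,x^{\ast}\rangle$ denote the value of $x^{\ast}\in X^{\ast}$ at $x\in X$. Operators are identified with their graphs: $(x,x^{\ast})\in T$ means $x^{\ast}\in T(x)$. An operator $T:X\rightrightarrows X^{\ast}$ is monotone if $\langle x_0-x_1,x_0^{\ast}-x_1^{\ast}\rangle\geq 0$ for all $(x_0,x_0^{\ast}),(x_1,x_1^{\ast})\in T$; it is maximally monotone if it is monotone and not properly contained in any other monotone operator. Its range is $\mathrm{range}\,T:=\bigcup_{x\in X}T(x)$. The zero element of $X$ is $0_X$. The Fenchel subdifferential operator of $f:X\to\mathbb{R}\cup\{+\infty\}$ is $\partial f(x):=\{x^{\ast}\in X^{\ast}: f(y)\geq f(x)+\langle y-x,x^{\ast}\rangle\ \forall y\in X\}$. A functional with values in $\mathbb{R}\cup\{+\infty\}$ is proper if it is not identically $+\infty$. A functional $s:X\to\mathbb{R}\cup\{+\infty\}$ is sublinear if it is convex and positively homogeneous, the latter meaning that $s(\lambda x)=\lambda s(x)$ for every $x\in s^{-1}(\mathbb{R})$ and every $\lambda\geq 0$. *)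

(* Defs.v *)
From HB Require Import structures.
From mathcomp Require Import all_boot all_order all_algebra.
From mathcomp Require Import all_classical all_reals all_analysis.

Set Implicit Arguments.
Unset Strict Implicit.
Unset Printing Implicit Defensive.

Import Order.TTheory GRing.Theory Num.Theory.
Import numFieldNormedType.Exports.

Local Open Scope classical_set_scope.
Local Open Scope ring_scope.

Section Dual.
Context {R : realType} (X : normedModType R).

Definition linear_continuous_pred : {pred (X -> R^o)} :=
  [pred f | `[< linear f /\ continuous f >]].

Record dual : Type := Dual {
  dual_fun :> X -> R^o ;
  dual_funP : dual_fun \in linear_continuous_pred }.

HB.instance Definition _ := [isSub for dual_fun].
HB.instance Definition _ := [Choice of dual by <:].

Fact linear_continuous_submod_closed : submod_closed linear_continuous_pred.
Proof.
split=> [|a f g].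
  apply/asboolP; split=> [b x y|]; last exact: cst_continuous.
  by rewrite /= addr0 scaler0.
move=> /asboolP[lf cf] /asboolP[lg cg]; apply/asboolP; split.
  move=> b x y; rewrite !fctE lf lg !scalerDr !scalerA addrACA.
  by rewrite (mulrC a b).
move=> x; apply: cvgD; last exact: cg.
by apply: cvgZr; exact: cf.
Qed.

HB.instance Definition _ := GRing.isSubmodClosed.Build R (X -> R^o)
  linear_continuous_pred linear_continuous_submod_closed.
HB.instance Definition _ := [SubChoice_isSubLmodule of dual by <:].

Fact dual_fun_linear (f : dual) : linear f.
Proof. by case: f => f /= /asboolP[]. Qed.

Fact dual_fun_continuous (f : dual) : continuous f.
Proof. by case: f => f /= /asboolP[]. Qed.

HB.instance Definition _ (f : dual) :=
  GRing.isLinear.Build R X R^o _ (dual_fun f) (@dual_fun_linear f).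

Definition pairing (x : X) (x' : dual) : R := x' x.

End Dual.

Section Operators.
Context {R : realType} {X : normedModType R}.
Implicit Types T : X -> set (dual X).

Definition graph T : set (X * dual X) := [set p | T p.1 p.2].

Definition op_range T : set (dual X) := \bigcup_x T x.

Definition monotone T : Prop :=
  forall (x0 x1 : X) (x0' x1' : dual X),
    graph T (x0, x0') -> graph T (x1, x1') ->
    0 <= pairing (x0 - x1) (x0' - x1').

Definition maximally_monotone T : Prop :=
  monotone T /\
  forall S : X -> set (dual X), monotone S -> ~ (graph T `<` graph S).

End Operators.

(* Functionals X -> R \cup {+oo} are functions into \bar R which avoid -oo;
   under that condition no sum below is of the indeterminate form +oo - oo. *)
Section Functionals.
Context {R : realType} {X : normedModType R}.
Implicit Types f s : X -> \bar R.
Local Open Scope ereal_scope.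

Definition avoids_ninfty f : Prop := forall x, f x != -oo.

Definition proper_fun f : Prop := exists x, f x != +oo.

(* Open weights: this way 0 * +oo never occurs. *)
Definition convex_fun f : Prop :=
  forall (x y : X) (t : R), (0 < t < 1)%R ->
    f (t *: x + (1 - t) *: y)%R <= t%:E * f x + (1 - t)%:E * f y.

Definition positively_homogeneous f : Prop :=
  forall (x : X) (l : R), f x \is a fin_num -> (0 <= l)%R ->
    f (l *: x)%R = l%:E * f x.

Definition sublinear f : Prop := convex_fun f /\ positively_homogeneous f.

Definition subdifferential f (x : X) : set (dual X) :=
  [set x' | forall y : X, f x + (pairing (y - x)%R x')%:E <= f y].

End Functionals.

(* Main.v *)
Require Import Defs.
From HB Require Import structures.
From mathcomp Require Import all_boot all_order all_algebra.
From mathcomp Require Import all_classical all_reals all_analysis.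
From mathcomp Require Import ring lra.

Set Implicit Arguments.
Unset Strict Implicit.
Unset Printing Implicit Defensive.

Import Order.TTheory GRing.Theory Num.Theory.
Import numFieldNormedType.Exports.

Local Open Scope classical_set_scope.
Local Open Scope ring_scope.

(** A monotone operator T with range T = T 0 lies below one canonical
    candidate: the support function s of the set T 0.  If x' is in T x,
    monotonicity against the points (0, y') with y' in T 0 says that x' attains
    the supremum defining s x, so x' is a subgradient of s at x; the
    maximality of T then turns the inclusion of T in the subdifferential of s
    into an equality.

    Conversely, homogeneity along the ray through x forces s x = <x, x'> for
    every subgradient x' at x, so that x' is also a subgradient at 0; this
    gives the range condition.  What remains is Rockafellar's theorem: the
    subdifferential of a proper lower semicontinuous convex function f on a
    Banach space is maximally monotone.  After tilting f by a linear
    functional, it amounts to the following statement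
    ([subgradient_towards]): if x0 does not minimize f, then some subgradient
    x' of f at some x satisfies 0 < <x0 - x, x'>.

    To find x, one penalizes the distance to x0.  A convex lower
    semicontinuous function decreases at most linearly, so for a level c below
    f x0 that f does go below, the slopes M for which
    c <= f y + M * |y - x0| everywhere form a nonempty set with a positive
    infimum.  A slope M close to this infimum is tight enough for some y to
    violate the inequality with slope 2/3 M ([steep_penalty]).  Started at y,
    Ekeland's variational principle ([ekeland]) for f + M * |. - x0| yields an
    exact minimizer x of f + M * |. - x0| + M/2 * |. - x|, close enough to y
    to differ from x0.  A Hahn-Banach argument on X * X
    ([hahn_banach_convex]) replaces both norms simultaneously by linear
    functionals; their sum, negated, is a subgradient of f at x, and since the
    first norm weighs more than the second, this subgradient is positive on
    x0 - x. *)

(** * Sublinear functionals and the Hahn-Banach theorem *)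
Section HahnBanach.
Context {R : realType} {V : lmodType R}.
Implicit Types (p q : V -> R) (K C : set (V * R)).

(** The inequality p (t *: x) <= t * p x for t > 0 already implies equality:
    apply it to t^-1 as well. *)
Definition sublin p : Prop :=
  (forall x y, p (x + y) <= p x + p y) /\
  (forall t x, 0 < t -> p (t *: x) <= t * p x).

Definition convex_cone K : Prop :=
  [/\ K (0, 0),
      forall a b, K a -> K b -> K (a.1 + b.1, a.2 + b.2)
    & forall t a, 0 < t -> K a -> K (t *: a.1, t * a.2)].

(** The infimal convolution of p with w |-> inf [set r | K (- w, r)].  When K is
    a convex cone on which p a.1 + a.2 is nonnegative, this is the largest
    sublinear functional below p whose value at - v is at most r for every
    (v, r) in K. *)
Definition inf_shift p K (x : V) : R := inf [set p (x + a.1) + a.2 | a in K].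

Lemma sublin0 p : sublin p -> p 0 = 0.
Proof.
move=> [pD pZ]; have := pD 0 0; have := pZ 2^-1 0; rewrite scaler0 addr0.
by move=> /(_ ltac:(lra)) h1 h2; lra.
Qed.

Lemma sublinN p x : sublin p -> - p (- x) <= p x.
Proof.
by move=> sp; have := sp.1 x (- x); rewrite subrr (sublin0 sp); lra.
Qed.

Section InfShift.
Variables (p : V -> R) (K : set (V * R)).
Hypotheses (sp : sublin p) (cK : convex_cone K).
Hypothesis pK : forall a, K a -> 0 <= p a.1 + a.2.

Let lbK x : lbound [set p (x + a.1) + a.2 | a in K] (- p (- x)).
Proof.
move=> _ [a Ka <-]; have := sp.1 (x + a.1) (- x); have := pK Ka.
by rewrite addrAC subrr add0r; lra.
Qed.

Let K0 x : [set p (x + a.1) + a.2 | a in K] !=set0.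
Proof. by exists (p (x + 0) + 0); exists (0, 0) => //; case: cK. Qed.

Lemma inf_shift_le x a : K a -> inf_shift p K x <= p (x + a.1) + a.2.
Proof. by move=> Ka; apply: ge_inf; [exists (- p (- x)); exact: lbK|exists a]. Qed.

Lemma le_inf_shift x r :
  (forall a, K a -> r <= p (x + a.1) + a.2) -> r <= inf_shift p K x.
Proof. by move=> h; apply: lb_le_inf => // _ [a Ka <-]; exact: h. Qed.

Lemma inf_shift_le_id x : inf_shift p K x <= p x.
Proof.
case: cK => k0 _ _; apply: le_trans (inf_shift_le x k0) _.
by rewrite /= !addr0.
Qed.

Lemma inf_shiftN a : K a -> inf_shift p K (- a.1) <= a.2.
Proof.
by move=> /(inf_shift_le (- a.1)); rewrite addNr (sublin0 sp) add0r.
Qed.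

Lemma sublin_inf_shift : sublin (inf_shift p K).
Proof.
case: cK => _ KD KZ; split=> [x y|t x t0].
  rewrite -lerBlDr; apply: le_inf_shift => a Ka.
  rewrite lerBlDr -lerBlDl; apply: le_inf_shift => b Kb.
  rewrite lerBlDl; apply: le_trans (inf_shift_le _ (KD _ _ Ka Kb)) _ => /=.
  by rewrite addrACA; have := sp.1 (x + a.1) (y + b.1); lra.
rewrite -ler_pdivrMl //; apply: le_inf_shift => a Ka.
rewrite ler_pdivrMl //; apply: le_trans (inf_shift_le _ (KZ _ _ t0 Ka)) _ => /=.
by rewrite -scalerDr mulrDr lerD2r; exact: sp.2.
Qed.

End InfShift.

(** A sublinear functional q can be pushed down to - q y at the point - y by an
    infimal convolution with the ray through (y, - q y).  Minimality of q says
    that this changes nothing, and comparing values gives additivity. *)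
Lemma minimal_sublin_additive q : sublin q ->
    (forall q', sublin q' -> (forall x, q' x <= q x) -> q' = q) ->
  {morph q : x y / x + y}.
Proof.
move=> sq qmin x y; apply/eqP; rewrite eq_le sq.1 /=.
pose K := [set (t *: y, - (t * q y)) | t in [set t : R | 0 <= t]].
have cK : convex_cone K.
  split=> [|a b [t /= t0 <-] [u /= u0 <-]|u a u0 [t /= t0 <-]] /=.
  - by exists 0; rewrite /= ?lexx// scale0r mul0r oppr0.
  - by exists (t + u); [exact: addr_ge0|rewrite scalerDl mulrDl opprD].
  - exists (u * t); first by apply: mulr_ge0 => //; exact: ltW.
    by rewrite scalerA mulrN mulrA.
have qK a : K a -> 0 <= q a.1 + a.2.
  move=> [t /= + <-] /=; rewrite le_eqVlt => /orP[/eqP<-|t0].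
    by rewrite scale0r mul0r oppr0 addr0 (sublin0 sq).
  have := sq.2 t^-1 (t *: y); rewrite invr_gt0 scalerA mulVf ?gt_eqF//.
  by rewrite scale1r => /(_ t0); rewrite ler_pdivlMl// => ?; lra.
have qE := qmin _ (sublin_inf_shift sq cK qK) (inf_shift_le_id sq cK qK).
have K1 : K (y, - q y) by exists 1; rewrite /= ?ler01// scale1r mul1r.
by have := inf_shift_le sq qK x K1; rewrite qE /=; lra.
Qed.

(** Zorn's lemma applies because a chain is bounded below pointwise by
    - p (- x), and the pointwise infimum of a chain of sublinear functionals
    is again sublinear. *)
Lemma exists_minimal_sublin p : sublin p ->
  exists q, [/\ sublin q, forall x, q x <= p x
    & forall q', sublin q' -> (forall x, q' x <= q x) -> q' = q].
Proof.
move=> sp; pose T := {q : V -> R | sublin q /\ forall x, q x <= p x}.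
pose below (q q' : T) := `[< forall x, sval q' x <= sval q x >].
have lbT (q : T) x : - p (- x) <= sval q x.
  by case: q => q /= [sq qp]; have := sublinN x sq; have := qp (- x); lra.
case: (@Zorn T below).
- by move=> q; apply/asboolP.
- move=> a b c /asboolP ab /asboolP bc; apply/asboolP => x.
  exact: le_trans (bc x) (ab x).
- move=> [a pa] [b pb] /asboolP /= ba /asboolP /= ab.
  have eab : a = b by apply/funext => x; apply/eqP; rewrite eq_le ab ba.
  by subst b; congr (exist _ _ _); exact: Prop_irrelevance.
- move=> A totA; have [[q0 Aq0]|A0] := pselect (A !=set0); last first.
    exists (exist _ p (conj sp (fun x => lexx (p x)))) => q Aq.
    by exfalso; apply: A0; exists q.
  pose m x := inf [set sval q x | q in A].
  have mle (q : T) x : A q -> m x <= sval q x.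
    move=> Aq; apply: ge_inf; last by exists q.
    by exists (- p (- x)) => _ [q' _ <-]; exact: lbT.
  have le_m r x : (forall q : T, A q -> r <= sval q x) -> r <= m x.
    move=> h; apply: lb_le_inf => [|_ [q Aq <-]]; last exact: h.
    by exists (sval q0 x); exists q0.
  have sm : sublin m.
    split=> [x y|t x t0].
      rewrite -lerBlDr; apply: (le_m) => a Aa.
      rewrite lerBlDr -lerBlDl; apply: (le_m) => b Ab; rewrite lerBlDl.
      have [/asboolP h|/asboolP h] := totA _ _ Aa Ab.
        apply: le_trans (mle b _ Ab) _; apply: le_trans ((svalP b).1.1 _ _) _.
        by rewrite lerD2r.
      apply: le_trans (mle a _ Aa) _; apply: le_trans ((svalP a).1.1 _ _) _.
      by rewrite lerD2l.
    rewrite -ler_pdivrMl //; apply: (le_m) => a Aa; rewrite ler_pdivrMl //.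
    by apply: le_trans (mle a _ Aa) _; exact: (svalP a).1.2.
  have mp x : m x <= p x by apply: le_trans (mle q0 x Aq0) _; exact: (svalP q0).2.
  by exists (exist _ m (conj sm mp)) => q Aq; apply/asboolP => x; exact: mle.
move=> [q [sq qp]] qmax; exists q; split=> // q' sq' q'q.
have q'p x : q' x <= p x := le_trans (q'q x) (qp x).
have /qmax [] : below (exist _ q (conj sq qp)) (exist _ q' (conj sq' q'p)).
  exact/asboolP.
by [].
Qed.

Lemma sublin_additive_linear q : sublin q -> {morph q : x y / x + y} ->
  linear (q : V -> R^o).
Proof.
move=> sq qD; have q0 := sublin0 sq.
have qN x : q (- x) = - q x.
  by apply/eqP; rewrite -addr_eq0 -qD addNr q0.
have qpos t x : 0 < t -> q (t *: x) = t * q x.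
  move=> t0; apply/eqP; rewrite eq_le sq.2 //=.
  by have := sq.2 t (- x) t0; rewrite scalerN !qN; lra.
move=> t x y; rewrite qD; congr (_ + _).
have [t0|t0|->] := ltgtP t 0; last by rewrite !scale0r q0.
  by rewrite -[t in LHS]opprK scaleNr qN qpos ?oppr_gt0// mulNr opprK.
exact: qpos.
Qed.

Theorem hahn_banach p : sublin p ->
  exists L : {linear V -> R^o}, forall x, L x <= p x.
Proof.
move=> /exists_minimal_sublin [q [sq qp qmin]].
have lq := sublin_additive_linear sq (minimal_sublin_additive sq qmin).
pose lin := GRing.isLinear.Build R V R^o _ q lq.
pose L : {linear V -> R^o} := HB.pack (q : V -> R^o) lin.
by exists L.
Qed.

Definition cone_hull C : set (V * R) :=
  [set (t *: a.1, t * a.2) | t in [set t : R | 0 <= t] & a in C].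

Definition convex_pairs C : Prop := forall a b t, 0 < t < 1 -> C a -> C b ->
  C (t *: a.1 + (1 - t) *: b.1, t * a.2 + (1 - t) * b.2).

Lemma convex_cone_hull C : C !=set0 -> convex_pairs C ->
  convex_cone (cone_hull C).
Proof.
move=> [c Cc] cC; split.
- exists 0; first by rewrite /=.
  by exists c => //; rewrite scale0r mul0r.
- move=> _ _ [t /= + [a Ca <-]] [u /= + [b Cb <-]] /=.
  rewrite le_eqVlt => /orP[/eqP<-|t0].
    by move=> u0; exists u => //; exists b => //; rewrite scale0r mul0r !add0r.
  rewrite le_eqVlt => /orP[/eqP<-|u0].
    by exists t; [exact: ltW|exists a; rewrite // scale0r mul0r !addr0].
  have tu0 : 0 < t + u by exact: addr_gt0.
  have tu : 0 < t / (t + u) < 1 by rewrite divr_gt0// ltr_pdivrMr// mul1r ltrDl.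
  exists (t + u); first exact: ltW.
  have tuE : 1 - t / (t + u) = u / (t + u) by field; rewrite gt_eqF.
  eexists; first exact: (cC a b _ tu Ca Cb).
  rewrite /= tuE scalerDr !scalerA; congr (_ *: _ + _ *: _, _).
  + by field; rewrite gt_eqF.
  + by field; rewrite gt_eqF.
  + by field; rewrite gt_eqF.
- move=> u _ u0 [t /= t0 [a Ca <-]] /=; exists (u * t).
    by apply: mulr_ge0 => //; exact: ltW.
  by exists a => //; rewrite scalerA mulrA.
Qed.

(** The Mazur-Orlicz form of the Hahn-Banach theorem.  The infimal convolution
    of p with the cone generated by C is still sublinear, the hypothesis being
    what keeps it finite; any linear functional below it does the job. *)
Theorem hahn_banach_convex p C : sublin p -> C !=set0 -> convex_pairs C ->
    (forall a, C a -> 0 <= p a.1 + a.2) ->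
  exists L : {linear V -> R^o},
    (forall x, L x <= p x) /\ (forall a, C a -> 0 <= L a.1 + a.2).
Proof.
move=> sp C0 cC pC; have cK := convex_cone_hull C0 cC.
have pK a : cone_hull C a -> 0 <= p a.1 + a.2.
  move=> [t /= + [b Cb <-]] /=; rewrite le_eqVlt => /orP[/eqP<-|t0].
    by rewrite scale0r mul0r addr0 (sublin0 sp).
  have := sp.2 t^-1 (t *: b.1); rewrite invr_gt0 scalerA mulVf ?gt_eqF//.
  rewrite scale1r => /(_ t0); rewrite ler_pdivlMl// => h.
  have : 0 <= t * (p b.1 + b.2) by apply: mulr_ge0; [exact: ltW|exact: pC].
  by lra.
have [L Lq] := hahn_banach (sublin_inf_shift sp cK pK).
exists L; split=> [x|a Ca].
  exact: le_trans (Lq x) (inf_shift_le_id sp cK pK x).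
have Ka : cone_hull C a.
  exists 1; rewrite /= ?ler01//; exists a => //.
  by rewrite scale1r mul1r -surjective_pairing.
have := le_trans (Lq (- a.1)) (inf_shiftN sp pK Ka).
by rewrite linearN; lra.
Qed.

End HahnBanach.

(** * Ekeland's variational principle *)
Section Ekeland.
Context {R : realType}.

Lemma lower_semicontinuousD (X : topologicalType) (f : X -> \bar R)
    (g : X -> R) :
  lower_semicontinuous f -> continuous g ->
  lower_semicontinuous (fun x => f x + (g x)%:E)%E.
Proof.
move=> lf cg x a afg.
have [b ab bf] : exists2 b : R, a - g x < b & (b%:E < f x)%E.
  case: (f x) afg => [r| |] //.
    rewrite -EFinD lte_fin => h; exists ((a - g x + r) / 2); first lra.
    by rewrite lte_fin; lra.
  by move=> _; exists (a - g x + 1); [lra|rewrite ltry].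
have [V nV Vf] := lf x b bf.
have ng : \forall y \near x, a - b < g y.
  by apply: (cvgr_gt _ (cg x)); lra.
exists (V `&` [set y | a - b < g y]); first exact: filterI.
move=> y [/Vf + /=]; case: (f y) => [r| |] //; last by rewrite addye ?ltry.
by rewrite -EFinD !lte_fin; lra.
Qed.

Lemma continuous_dist (X : normedModType R) (e : R) (x : X) :
  continuous (fun y => e * `|y - x|).
Proof.
move=> y; apply: cvgM; first exact: cvg_cst.
by apply: cvg_norm; apply: cvgB => //; exact: cvg_cst.
Qed.

(** Write y in S x when F y + e * |y - x| <= F x, a closed preorder.  Choosing
    u n.+1 in S (u n) to minimize F up to n.+1^-1 makes the sets S (u n) shrink
    to a point; their common limit cannot be improved.  The bound on
    |x - x0| in the conclusion is what later locates x. *)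
Theorem ekeland (X : completeNormedModType R) (F : X -> \bar R) (m e : R)
    (x0 : X) : lower_semicontinuous F -> (forall y, m%:E <= F y)%E ->
    F x0 \is a fin_num -> 0 < e ->
  exists x, (F x + (e * `|x - x0|)%:E <= F x0)%E /\
    (forall y, F x <= F y + (e * `|y - x|)%:E)%E.
Proof.
move=> lF mF F0 e0.
pose S x : set X := [set y | (F y + (e * `|y - x|)%:E <= F x)%E].
have fin_S x y : F x \is a fin_num -> S x y -> F y \is a fin_num.
  rewrite /S /=; have := mF y; case: (F x) => // r; case: (F y) => //.
have S_real x y : F x \is a fin_num -> S x y ->
    fine (F y) + e * `|y - x| <= fine (F x).
  move=> Fx Sxy; have Fy := fin_S _ _ Fx Sxy; move: Sxy.
  by rewrite /S /= -(fineK Fx) -(fineK Fy) -EFinD lee_fin.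
have S_refl x : S x x by rewrite /S /= subrr normr0 mulr0 adde0.
have S_trans x y z : F x \is a fin_num -> S x y -> S y z -> S x z.
  move=> Fx Sxy Syz; have Fy := fin_S _ _ Fx Sxy; have Fz := fin_S _ _ Fy Syz.
  rewrite /S /= -(fineK Fx) -(fineK Fz) -EFinD lee_fin.
  have := S_real _ _ Fx Sxy; have := S_real _ _ Fy Syz.
  have : e * `|z - x| <= e * `|z - y| + e * `|y - x|.
    by rewrite -mulrDr ler_pM2l// ler_distD.
  by lra.
have step (p : nat * X) : exists y, F p.2 \is a fin_num ->
    S p.2 y /\ (forall z, S p.2 z -> F y <= F z + (p.1.+1%:R^-1)%:E)%E.
  case: p => n x /=; have [Fx|_] := boolP (F x \is a fin_num); last by exists x.
  have Ifin : ereal_inf [set F z | z in S x] \is a fin_num.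
    have h1 : (m%:E <= ereal_inf [set F z | z in S x])%E.
      by apply: le_ereal_inf_tmp => _ [z _ <-]; exact: mF.
    have h2 : (ereal_inf [set F z | z in S x] <= F x)%E.
      by apply: ereal_inf_lbound; exists x.
    by move: Fx h1 h2; case: (F x) => // r; case: ereal_inf.
  have n0 : 0 < n.+1%:R^-1 :> R by rewrite invr_gt0.
  have [_ [y Sy <-] yI] := lb_ereal_inf_adherent n0 Ifin.
  exists y => _; split=> // z Sz; apply: le_trans (ltW yI) _.
  by rewrite leeD2r//; apply: ereal_inf_lbound; exists z.
have {step}[next nextP] := choice step.
pose u := fix u n := if n is k.+1 then next (k, u k) else x0.
have Fu n : F (u n) \is a fin_num.
  elim: n => //= n IH; exact: fin_S IH (nextP (n, u n) IH).1.
have uS n k : S (u n) (u (n + k)%N).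
  elim: k => [|k IH]; first by rewrite addn0.
  rewrite addnS /=; apply: S_trans (Fu n) IH _.
  exact: (nextP (_, _) (Fu _)).1.
have u_inf n z : S (u n) z -> fine (F (u n.+1)) <= fine (F z) + n.+1%:R^-1.
  move=> Sz; have := (nextP (n, u n) (Fu n)).2 z Sz.
  rewrite -lee_fin EFinD (fineK (Fu n.+1)) fineK//; exact: fin_S (Fu n) Sz.
have near_u n z : S (u n.+1) z -> e * `|z - u n.+1| <= n.+1%:R^-1.
  move=> Sz; have Sz' := S_trans _ _ _ (Fu n) (nextP (n, u n) (Fu n)).1 Sz.
  have Fz := fin_S _ _ (Fu n) Sz'.
  rewrite -(lerD2l (fine (F z))).
  exact: le_trans (S_real _ _ (Fu n.+1) Sz) (u_inf _ _ Sz').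
have small (d : R) : 0 < d -> exists n : nat, n.+1%:R^-1 < d.
  by move=> /ltr_add_invr [n]; rewrite add0r; exists n.
have cu : cvgn u.
  apply/cauchy_cvgP/cauchy_exP => d /= d0.
  have [n nd] := small _ (mulr_gt0 e0 d0).
  exists (u n.+1); exists n.+1 => // k /= /subnKC <-.
  rewrite -ball_normE /= distrC -(ltr_pM2l e0).
  exact: le_lt_trans (near_u n _ (uS _ _)) nd.
pose l : X := lim (u @ \oo).
have Sl n : S (u n) l.
  rewrite /S /= leNgt; apply/negP; rewrite -{1}(fineK (Fu n)).
  move=> /(lower_semicontinuousD lF (@continuous_dist X e (u n))) [V nV Vgt].
  have [N _ NV] : \forall k \near \oo, V (u k) by exact: cu V nV.
  have := Vgt _ (NV (n + N)%N (leq_addl _ _)).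
  by rewrite (fineK (Fu n)) ltNge uS.
exists l; split; first exact: (Sl 0%N).
move=> y; rewrite leNgt; apply/negP => yl.
have Sly : S l y by exact: ltW.
have Fl : F l \is a fin_num := fin_S _ _ F0 (Sl 0%N).
have Fy := fin_S _ _ Fl Sly.
have yl' : fine (F y) < fine (F l).
  move: yl; rewrite -{1}(fineK Fy) -{1}(fineK Fl) -EFinD lte_fin.
  by apply: le_lt_trans; rewrite lerDl mulr_ge0// ltW.
have [n] := small _ (ltac:(rewrite subr_gt0; exact: yl') : 0 < fine (F l) - fine (F y)).
have := S_real _ _ (Fu n.+1) (Sl n.+1).
have : 0 <= e * `|l - u n.+1| by rewrite mulr_ge0// ltW.
have := u_inf _ _ (S_trans _ _ _ (Fu n) (Sl n) Sly).
by move: (_^-1) => d; lra.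
Qed.

End Ekeland.

(** * Subgradients of convex functions in a prescribed direction *)
Section Rockafellar.
Context {R : realType}.

Lemma bounded_linear_dual (X : normedModType R) (g : X -> R^o) (k : R) :
  linear g -> (forall x, g x <= k * `|x|) ->
  exists x' : dual X, x' = g :> (X -> R^o).
Proof.
move=> lg gk; pose lin := GRing.isLinear.Build R X R^o _ g lg.
pose L : {linear X -> R^o} := HB.pack (g : X -> R^o) lin.
suff cg : continuous L.
  have gP : g \in @linear_continuous_pred R X by apply/asboolP; split.
  by exists (Dual gP).
apply/linear_bounded_continuous/linear_boundedP; exists k; split.
  exact: num_real.
move=> r kr x; rewrite ler_norml; apply/andP; split.
  have := gk (- x); rewrite normrN -[g (- x)]/(L (- x)) linearN lerNl => h.
  by apply: le_trans h; rewrite lerN2; apply: ler_wpM2r (ltW kr).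
apply: le_trans (gk x) _; exact: ler_wpM2r (ltW kr).
Qed.

Lemma convex_fun_le (X : normedModType R) (f : X -> \bar R) x y (r s t : R) :
  convex_fun f -> (f x <= r%:E)%E -> (f y <= s%:E)%E -> 0 < t < 1 ->
  (f (t *: x + (1 - t) *: y)%R <= (t * r + (1 - t) * s)%:E)%E.
Proof.
move=> cf fx fy t01; have /andP[t0 t1] := t01.
apply: le_trans (cf x y t t01) _; rewrite [leRHS]EFinD !EFinM.
by apply: leeD; apply: lee_wpmul2l => //; rewrite lee_fin; lra.
Qed.

(** A large drop of f far away from z would, by convexity, show up
    proportionally on the small ball around z on which f stays above
    f z - 1. *)
Lemma convex_lsc_minorant (X : normedModType R) (f : X -> \bar R) z :
    convex_fun f -> lower_semicontinuous f -> f z \is a fin_num ->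
    avoids_ninfty f ->
  exists a b : R, 0 <= b /\ forall y, ((a - b * `|y - z|)%:E <= f y)%E.
Proof.
move=> cf lf fz nf.
have h1 : ((fine (f z) - 1)%:E < f z)%E by rewrite -{2}(fineK fz) lte_fin; lra.
have [V /nbhs_ballP [d /= d0 dV] Vf] := lf z _ h1.
exists (fine (f z) - 1), (2 / d); split; first by rewrite divr_ge0// ltW.
move=> y; move: (nf y); case E: (f y) => [r| |] // _; last by rewrite leey.
rewrite lee_fin; have dz : 0 <= 2 / d * `|y - z|.
  by rewrite mulr_ge0// divr_ge0// ltW.
have [yd|dy] := ltP `|y - z| d.
  have /dV/Vf : ball z d y by rewrite -ball_normE /= distrC.
  by rewrite E lte_fin; lra.
have n0 : 0 < `|y - z| by exact: lt_le_trans dy.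
(* t brings y to distance d / 2 from z, inside the ball. *)
pose t := d / (2 * `|y - z|).
have tn : t * `|y - z| = d / 2 by rewrite /t; field; rewrite gt_eqF.
have t0 : 0 < t by rewrite divr_gt0// mulr_gt0.
have t01 : 0 < t < 1.
  by rewrite t0 /= ltr_pdivrMr ?mulr_gt0// mul1r; lra.
have : (f (t *: y + (1 - t) *: z)%R <= (t * r + (1 - t) * fine (f z))%:E)%E.
  by apply: convex_fun_le => //; rewrite ?E ?fineK.
have /dV/Vf : ball z d (t *: y + (1 - t) *: z).
  rewrite -ball_normE /= distrC scalerBl scale1r addrCA addrAC subrr add0r.
  by rewrite -scalerBr normrZ gtr0_norm// tn; lra.
move=> /lt_le_trans /[apply]; rewrite lte_fin => h.
have te : 2 / d * `|y - z| = t^-1.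
  by rewrite /t; field; rewrite !gt_eqF.
have : 0 <= t * (r - fine (f z) + t^-1).
  by rewrite mulrDr mulfV ?gt_eqF//; lra.
by rewrite pmulr_rge0// te; lra.
Qed.

(** The slopes M making c - M * |. - x0| a minorant of f are bounded away from
    0, because f z < c, and exist, because of [convex_lsc_minorant] far from x0
    and lower semicontinuity near x0.  Any admissible M below 3/2 times their
    infimum is then such that the slope 2/3 M is no longer admissible. *)
Lemma steep_penalty (X : normedModType R) (f : X -> \bar R) x0 z :
    convex_fun f -> lower_semicontinuous f -> avoids_ninfty f ->
    (f z < f x0)%E ->
  exists (c M : R) (y : X), [/\ 0 < M,
    forall y, ((c - M * `|y - x0|)%:E <= f y)%E
    & (f y < (c - 2 / 3 * M * `|y - x0|)%:E)%E].
Proof.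
move=> cf lf nf fzx; have fz : f z \is a fin_num.
  by move: fzx (nf z); case: (f z) => // ; case: (f x0).
have [c zc cx] : exists2 c : R, fine (f z) < c & (c%:E < f x0)%E.
  move: fzx; rewrite -{1}(fineK fz); case: (f x0) => [r| |] //.
    by rewrite lte_fin => h; exists ((fine (f z) + r) / 2); rewrite ?lte_fin; lra.
  by move=> _; exists (fine (f z) + 1); rewrite ?ltry//; lra.
have zx : 0 < `|z - x0|.
  by rewrite normr_gt0 subr_eq0; apply: contraTneq fzx => ->; rewrite ltxx.
pose A := [set M | forall y, ((c - M * `|y - x0|)%:E <= f y)%E].
have lbA : lbound A ((c - fine (f z)) / `|z - x0|).
  move=> M /(_ z); rewrite -(fineK fz) lee_fin ler_pdivrMr// => h.
  by rewrite /= in h *; lra.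
have A0 : A !=set0.
  have [a [b [b0 ab]]] := convex_lsc_minorant cf lf fz nf.
  have [V /nbhs_ballP [d /= d0 dV] Vf] := lf x0 _ cx.
  pose a' := a - b * `|z - x0|.
  (* The slope b handles the minorant; the surplus makes up for c - a' as soon
     as y is at distance d from x0. *)
  exists (b + `|c - a'| / d) => y.
  have k0 : 0 <= `|c - a'| / d by rewrite divr_ge0// ltW.
  have [yd|dy] := ltP `|y - x0| d.
    have /dV/Vf : ball x0 d y by rewrite -ball_normE /= distrC.
    move=> /ltW; apply: le_trans; rewrite lee_fin gerBl.
    by rewrite mulr_ge0// addr_ge0.
  apply: le_trans (ab y); rewrite lee_fin mulrDl.
  have h1 : `|c - a'| <= `|c - a'| / d * `|y - x0|.
    by rewrite -mulrA ler_peMr// ler_pdivlMl// mulr1.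
  have h2 := ler_norm (c - a').
  have h3 : b * `|y - z| <= b * `|y - x0| + b * `|z - x0|.
    by rewrite -mulrDr ler_wpM2l// (distrC z) ler_distD.
  by rewrite /a' in h1 h2 *; lra.
have iA : has_inf A by split=> //; eexists; exact: lbA.
have i0 : 0 < inf A.
  apply: lt_le_trans (lb_le_inf A0 lbA); rewrite divr_gt0//; lra.
have [M AM Mi] := inf_adherent (ltac:(lra) : 0 < inf A / 2) iA.
have Mge : inf A <= M by apply: ge_inf => //; case: iA.
have : ~ A (2 / 3 * M).
  by move=> /(ge_inf iA.2); lra.
move=> /existsNP [y /negP]; rewrite -ltNge => fy.
by exists c, M, y; split=> //; lra.
Qed.

(** Ekeland's principle started at the point y1 of [steep_penalty] moves by less
    than 2/3 |y1 - x0|: F = f + M * |. - x0| drops by at most M/3 * |y1 - x0|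
    and the slope is M/2.  Hence the point found is not x0. *)
Lemma almost_minimizer (X : completeNormedModType R) (f : X -> \bar R) x0 z :
    convex_fun f -> lower_semicontinuous f -> avoids_ninfty f ->
    (f z < f x0)%E ->
  exists (M : R) (x : X), [/\ 0 < M, x != x0, f x \is a fin_num
    & forall y, (f x + (M * `|x - x0|)%:E <=
                 f y + (M * `|y - x0|)%:E + (M / 2 * `|y - x|)%:E)%E].
Proof.
move=> cf lf nf fzx.
have [c [M [y1 [M0 cM fy1]]]] := steep_penalty cf lf nf fzx.
pose F y := (f y + (M * `|y - x0|)%:E)%E.
have lF : lower_semicontinuous F.
  by apply: lower_semicontinuousD => //; exact: continuous_dist.
have cF y : (c%:E <= F y)%E.
  by have := cM y; rewrite -leeBlDr// -EFinB.
have ff : f y1 \is a fin_num.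
  by move: fy1 (nf y1); case: (f y1).
have F1 : F y1 \is a fin_num by rewrite /F fin_numD ff.
have [x [xy1 xmin]] := ekeland lF cF F1 (ltac:(lra) : 0 < M / 2).
have fx : f x \is a fin_num.
  by move: xy1 (nf x); rewrite /F -(fineK ff); case: (f x).
exists M, x; split=> //.
move: xy1 (cF x) fy1; rewrite /F -(fineK ff) -(fineK fx) -!EFinD !lee_fin lte_fin.
move=> h1 h2 h3; apply/eqP => xx0; subst x.
move: h1 h2; rewrite (distrC x0 y1) subrr normr0 => h1 h2.
have : 0 <= M * `|y1 - x0| by rewrite mulr_ge0// ltW.
by lra.
Qed.

(** The sum rule for f + M * |. - x0| + e * |. - x| at its minimizer x, made
    explicit.  Linearizing the two norms together needs a single sublinear
    functional on X * X, evaluated at the pair (y - x0, y - x); a linear L below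
    it must agree with the first norm at x - x0, since the minimum is attained
    at y = x. *)
Lemma exact_penalty_subgradient (X : normedModType R) (f : X -> \bar R)
    (x0 x : X) (M e : R) :
    convex_fun f -> f x \is a fin_num -> 0 <= M -> 0 <= e ->
    (forall y, (f x + (M * `|x - x0|)%:E <=
                f y + (M * `|y - x0|)%:E + (e * `|y - x|)%:E)%E) ->
  exists2 x' : dual X, subdifferential f x x' &
    (M - e) * `|x0 - x| <= pairing (x0 - x) x'.
Proof.
move=> cf fx M0 e0 xmin.
pose V : lmodType R := (X * X)%type.
pose p (v : V) := M * `|v.1| + e * `|v.2|.
pose c := fine (f x) + M * `|x - x0|.
pose C : set (V * R) :=
  [set a | exists y r, (f y <= r%:E)%E /\ a = ((y - x0, y - x), r - c)].
have sp : sublin p.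
  split=> [u v|t u t0]; rewrite /p /=.
    have := ler_wpM2l M0 (ler_normD u.1 v.1).
    by have := ler_wpM2l e0 (ler_normD u.2 v.2); lra.
  by rewrite !normrZ gtr0_norm// mulrDr !(mulrCA t).
have C0 : C !=set0.
  by eexists; exists x, (fine (f x)); split; [rewrite fineK|reflexivity].
have cC : convex_pairs C.
  move=> _ _ t t01 [y [r [fy ->]]] [z [s [fz ->]]] /=.
  exists (t *: y + (1 - t) *: z), (t * r + (1 - t) * s).
  split; first exact: convex_fun_le.
  have seg w : t *: (y - w) + (1 - t) *: (z - w) = t *: y + (1 - t) *: z - w.
    by rewrite !scalerBr addrACA -opprD -scalerDl [t + _]addrC subrK scale1r.
  by congr ((_, _), _); [exact: seg|exact: seg|ring].
have pC a : C a -> 0 <= p a.1 + a.2.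
  move=> [y [r [fy ->]]] /=; have := xmin y.
  rewrite -addeA -EFinD -(fineK fx) -EFinD => h.
  have := le_trans h (leeD2r _ fy); rewrite -EFinD lee_fin /p /c /=; lra.
have [L [Lp LC]] := hahn_banach_convex sp C0 cC pC.
have Lxy y r : (f y <= r%:E)%E -> c <= L (y - x0, y - x) + r.
  by move=> fy; have /LC /= : C ((y - x0, y - x), r - c) by [exists y, r|]; lra.
have Lsplit (u w : X) : L (u, w) = L (u, 0) + L (0, w).
  by rewrite -linearD; congr (L _); congr (_, _); rewrite /= ?addr0 ?add0r.
have L1 (u : X) : L (u, 0) <= M * `|u|.
  by apply: le_trans (Lp _) _; rewrite /p /= normr0 mulr0 addr0.
have L2 (u : X) : - (e * `|u|) <= L (0, u).
  have := Lp (0, - u); rewrite /p /= normr0 mulr0 add0r normrN.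
  have -> : (0, - u) = - (0, u) :> V by congr (_, _); rewrite /= oppr0.
  by rewrite linearN; lra.
(* With L1, this makes L agree with the first norm at x - x0. *)
have Lx : M * `|x - x0| <= L (x - x0, 0).
  have := Lxy x (fine (f x)); rewrite fineK// subrr => /(_ (lexx _)).
  by rewrite /c; lra.
have lin : linear (fun u : X => - L (u, u) : R^o).
  move=> t u w; have -> : (t *: u + w, t *: u + w) = t *: (u, u) + (w, w) :> V by [].
  by rewrite linearP opprD scalerN.
have bnd (u : X) : - L (u, u) <= (M + e) * `|u|.
  rewrite -linearN; apply: le_trans (Lp _) _.
  by rewrite /p /= !normrN mulrDl.
have [x' x'E] := bounded_linear_dual lin bnd.
exists x'; last first.
  rewrite /pairing x'E -linearN.
  have -> : - (x0 - x, x0 - x) = (x - x0, x - x0) :> V.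
    by congr (_, _); rewrite /= opprB.
  by rewrite Lsplit (distrC x0); have := L2 (x - x0); lra.
move=> y; case E: (f y) => [r| |]; last 2 first.
- by rewrite leey.
- by have := xmin y; rewrite E -(fineK fx).
rewrite -(fineK fx) -EFinD lee_fin /pairing x'E.
have := Lxy y r; rewrite E => /(_ (lexx _)).
have -> : (y - x0, y - x) = (y - x, y - x) + (x - x0, 0) :> V.
  by congr (_, _); rewrite /= ?addr0// addrA subrK.
by rewrite linearD /c; have := L1 (x - x0); lra.
Qed.

Lemma subgradient_towards (X : completeNormedModType R) (f : X -> \bar R) x0 z :
    convex_fun f -> lower_semicontinuous f -> avoids_ninfty f ->
    (f z < f x0)%E ->
  exists x (x' : dual X), subdifferential f x x' /\ 0 < pairing (x0 - x) x'.
Proof.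
move=> cf lf nf fzx.
have [M [x [M0 xx0 fx xmin]]] := almost_minimizer cf lf nf fzx.
have M2 : 0 <= M / 2 by lra.
have [x' fx' x'M] := exact_penalty_subgradient cf fx (ltW M0) M2 xmin.
exists x, x'; split=> //; apply: lt_le_trans x'M.
by rewrite mulr_gt0 ?normr_gt0 ?subr_eq0 1?eq_sym//; lra.
Qed.

End Rockafellar.

(** * Subdifferentials and support functions *)
Section Subdifferential.
Context {R : realType} {X : normedModType R}.
Implicit Types (f s : X -> \bar R) (T : X -> set (dual X)).

Lemma convex_fun_epigraph f : avoids_ninfty f ->
    (forall x y (r s t : R), (f x <= r%:E)%E -> (f y <= s%:E)%E -> 0 < t < 1 ->
      (f (t *: x + (1 - t) *: y)%R <= (t * r + (1 - t) * s)%:E)%E) ->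
  convex_fun f.
Proof.
move=> nf ef x y t t01; have /andP[t0 t1] := t01.
have u0 : 0 < 1 - t by lra.
move: (nf x) (nf y) (fun a b fx fy => ef x y a b t fx fy t01).
case: (f x) => [r| |] //; case: (f y) => [s| |] // _ _ fxy.
- by rewrite -!EFinM -EFinD; exact: fxy.
- by rewrite gt0_muley ?lte_fin// addey// leey.
- by rewrite gt0_muley ?lte_fin// -EFinM addye// leey.
- by rewrite !gt0_muley ?lte_fin// leey.
Qed.

Lemma subdifferential_fin_num f x x' : avoids_ninfty f -> proper_fun f ->
  subdifferential f x x' -> f x \is a fin_num.
Proof.
move=> nf [y fy] /(_ y); move: (nf x) (nf y) fy.
by case: (f x) => //; case: (f y).
Qed.

Lemma pairingBl (x y : X) (x' : dual X) :
  pairing (x - y) x' = pairing x x' - pairing y x'.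
Proof. exact: linearB. Qed.

Lemma pairingDr (x : X) (x' y' : dual X) :
  pairing x (x' + y') = pairing x x' + pairing x y'.
Proof. by []. Qed.

Lemma pairingBr (x : X) (x' y' : dual X) :
  pairing x (x' - y') = pairing x x' - pairing x y'.
Proof. by []. Qed.

Lemma pairing0 (x' : dual X) : pairing 0 x' = 0.
Proof. exact: linear0. Qed.

Lemma pairingZ t (x : X) (x' : dual X) : pairing (t *: x) x' = t * pairing x x'.
Proof. exact: linearZ. Qed.

Lemma pairingD (x y : X) (x' : dual X) :
  pairing (x + y) x' = pairing x x' + pairing y x'.
Proof. exact: linearD. Qed.

Lemma subdifferential_monotone f : avoids_ninfty f -> proper_fun f ->
  Defs.monotone (subdifferential f).
Proof.
move=> nf pf x y x' y' fx fy.
have fxn := subdifferential_fin_num nf pf fx.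
have fyn := subdifferential_fin_num nf pf fy.
move: (fx y) (fy x); rewrite -(fineK fxn) -(fineK fyn) -!EFinD !lee_fin.
by rewrite pairingBr !pairingBl; lra.
Qed.

Lemma maximally_monotone_sub T S : maximally_monotone T -> Defs.monotone S ->
  (forall x, T x `<=` S x) -> T = S.
Proof.
move=> [_ maxT] mS TS; apply/funext => x; apply/seteqP; split; first exact: TS.
move=> x' Sx; apply: contrapT => Tx; apply: (maxT S mS); split.
  by move=> [y y']; exact: TS.
by move=> /(_ (x, x') Sx).
Qed.

(** The empty graph is properly contained in that of a single point. *)
Lemma maximally_monotone_neq0 T : maximally_monotone T ->
  exists x, T x !=set0.
Proof.
move=> [mT maxT]; apply: contrapT => T0.
have TE x x' : ~ T x x' by move=> Tx; apply: T0; exists x, x'.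
apply: (maxT (fun x => [set x' | x = 0 /\ x' = 0])).
  move=> x y x' y' [/= -> _] [/= -> _].
  by have := pairing0 (x' - y'); rewrite subrr => /= ->.
split; first by move=> [x x'] /TE.
by move=> /(_ (0, 0) (conj erefl erefl)) /TE.
Qed.

Lemma sublinear_at0 s : avoids_ninfty s -> proper_fun s -> sublinear s ->
  s 0 = 0%E.
Proof.
move=> ns [x sx] [_ hs]; have fx : s x \is a fin_num.
  by move: (ns x) sx; case: (s x).
by have := hs x 0 fx (lexx 0); rewrite scale0r mul0e.
Qed.

(** A subgradient at x, tested at 0 and at 2 *: x, has to agree with s at x;
    the subgradient inequality then loses its dependence on x. *)
Lemma sublinear_subdifferentialP s : avoids_ninfty s -> proper_fun s ->
    sublinear s -> forall x x', subdifferential s x x' <->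
  s x = (pairing x x')%:E /\ forall y, ((pairing y x')%:E <= s y)%E.
Proof.
move=> ns ps ls x x'; split=> [sx|[sx sy] y]; last first.
  by rewrite sx -EFinD pairingBl addrC subrK.
have fx := subdifferential_fin_num ns ps sx.
have sE : s x = (pairing x x')%:E.
  have := sx 0; have := sx (2 *: x).
  rewrite (sublinear_at0 ns ps ls) ls.2//.
  rewrite -(fineK fx) -EFinM -!EFinD !lee_fin !pairingBl pairingZ pairing0.
  by move=> h1 h2; congr (_%:E); apply/eqP; rewrite eq_le; apply/andP; split; lra.
by split=> // y; have := sx y; rewrite sE -EFinD pairingBl addrC subrK.
Qed.

Lemma range_subdifferential_sublinear s : avoids_ninfty s -> proper_fun s ->
  sublinear s -> op_range (subdifferential s) = subdifferential s 0.
Proof.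
move=> ns ps ls; apply/seteqP; split=> x'; last by move=> ?; exists 0.
have sP := sublinear_subdifferentialP ns ps ls.
move=> [x _ /sP [_ sx']]; apply/sP; split=> //.
by rewrite pairing0 (sublinear_at0 ns ps ls).
Qed.

Definition support_fun (A : set (dual X)) (x : X) : \bar R :=
  ereal_sup [set (pairing x x')%:E | x' in A].

Lemma support_fun_ge A x x' : A x' -> ((pairing x x')%:E <= support_fun A x)%E.
Proof. by move=> Ax'; apply: ereal_sup_ubound; exists x'. Qed.

Lemma support_fun_le A x c : (forall x', A x' -> ((pairing x x')%:E <= c)%E) ->
  (support_fun A x <= c)%E.
Proof. by move=> h; apply: ge_ereal_sup => _ [x' /h ? <-]. Qed.

Lemma support_fun_avoids_ninfty A : A !=set0 -> avoids_ninfty (support_fun A).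
Proof.
move=> [x' Ax'] x; have := support_fun_ge x Ax'.
by case: (support_fun A x).
Qed.

Lemma support_fun0 A : A !=set0 -> support_fun A 0 = 0%E.
Proof.
move=> [x' Ax']; apply/eqP; rewrite eq_le; apply/andP; split.
  by apply: support_fun_le => y' _; rewrite pairing0.
by rewrite -[0%E]/(0%:E) -(pairing0 x'); exact: support_fun_ge.
Qed.

Lemma support_fun_lsc A : lower_semicontinuous (support_fun A).
Proof.
move=> x a /ereal_sup_gt [_ [x' Ax' <-]]; rewrite lte_fin => ax.
exists [set y | a < pairing y x'].
  exact: (cvgr_gt _ (@dual_fun_continuous _ _ x' x)).
by move=> y /= ay; apply: lt_le_trans (support_fun_ge y Ax'); rewrite lte_fin.
Qed.

Lemma support_fun_sublinear A : A !=set0 -> sublinear (support_fun A).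
Proof.
move=> A0; split=> [x y t /andP[t0 t1]|x t].
  apply: support_fun_le => x' Ax'; rewrite pairingD !pairingZ EFinD !EFinM.
  by apply: leeD; apply: lee_wpmul2l; rewrite ?lee_fin ?support_fun_ge//; lra.
move=> _; rewrite le_eqVlt => /orP[/eqP<-|t0].
  by rewrite scale0r mul0e support_fun0.
have half (u : R) z : 0 < u ->
    (support_fun A (u *: z)%R <= u%:E * support_fun A z)%E.
  move=> u0; apply: support_fun_le => x' Ax'; rewrite pairingZ EFinM.
  by apply: lee_wpmul2l; [rewrite lee_fin ltW|exact: support_fun_ge].
apply/eqP; rewrite eq_le half//=.
have := half t^-1 (t *: x); rewrite invr_gt0 => /(_ t0).
rewrite scalerA mulVf ?gt_eqF// scale1r => /(lee_wpmul2l (ltW t0 : (0 <= t%:E)%E)).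
by rewrite muleA -EFinM mulfV ?gt_eqF// mul1e.
Qed.

(** The graph of T is contained in that of the subdifferential, because
    monotonicity of T against (0, y') reads <x, y'> <= <x, x'>; both operators
    being monotone, maximality forces equality. *)
Lemma maximally_monotone_support_fun T : maximally_monotone T ->
  op_range T = T 0 -> T = subdifferential (support_fun (T 0)) /\ T 0 !=set0.
Proof.
move=> mT rT.
have TT0 x x' : T x x' -> T 0 x' by move=> Tx; rewrite -rT; exists x.
have [x1 [x1' /TT0 T0x1']] := maximally_monotone_neq0 mT.
have T0 : T 0 !=set0 by exists x1'.
split=> //; apply: maximally_monotone_sub => //.
  apply: subdifferential_monotone; first exact: support_fun_avoids_ninfty.
  by exists 0; rewrite support_fun0.
move=> x x' Tx y; apply: le_trans (support_fun_ge y (TT0 _ _ Tx)).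
rewrite pairingBl -leeBrDr// -EFinB opprB addrCA subrr addr0.
apply: support_fun_le => y' Ty'; rewrite lee_fin.
have := mT.1 x 0 x' y' Tx Ty'; rewrite subr0.
by rewrite pairingBr subr_ge0.
Qed.

End Subdifferential.

(** Rockafellar's theorem.  If a monotone S extends the subdifferential of f
    and contains a pair (x0, x0') outside of it, then x0 does not minimize
    f - x0'.  A subgradient of f - x0' at some x that is positive on x0 - x,
    translated back by x0', contradicts the monotonicity of S. *)
Theorem subdifferential_maximally_monotone (R : realType)
    (X : completeNormedModType R) (f : X -> \bar R) :
  convex_fun f -> lower_semicontinuous f -> avoids_ninfty f -> proper_fun f ->
  maximally_monotone (subdifferential f).
Proof.
move=> cf lf nf pf; split; first exact: subdifferential_monotone.
move=> S mS [fS]; apply => -[x0 x0'] /= Sx0.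
move=> z /=; rewrite leNgt; apply/negP => fz.
pose g x := (f x + (- pairing x x0')%:E)%E.
have gE x r : (g x <= r%:E)%E = (f x <= (r + pairing x x0')%:E)%E.
  by rewrite /g EFinN leeBlDr// -EFinD.
have ng : avoids_ninfty g by move=> x; move: (nf x); rewrite /g; case: (f x).
have cg : convex_fun g.
  apply: convex_fun_epigraph => // x y r q t; rewrite !gE => fx fy t01.
  apply: le_trans (convex_fun_le cf fx fy t01) _; rewrite lee_fin.
  by rewrite pairingD !pairingZ; lra.
have lg : lower_semicontinuous g.
  apply: lower_semicontinuousD => // x; apply: cvgN.
  exact: dual_fun_continuous.
have gz : (g z < g x0)%E.
  move: fz; rewrite /g pairingBl; case: (f z) (nf z) => [a| |]// _; last first.
    by rewrite ltNge leey.
  case: (f x0) (nf x0) => [b| |] // _ h; last by rewrite addye ?ltry.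
  by move: h; rewrite -!EFinD !lte_fin; lra.
have [x [x' [gx x'0]]] := subgradient_towards cg lg ng gz.
have fx : subdifferential f x (x' + x0').
  move=> y; move: (gx y) (nf x) (nf y); rewrite /g.
  rewrite pairingDr pairingBl (pairingBl _ _ x0').
  case: (f x) => [b| |] //; case: (f y) => [a| |] // h _ _.
    by move: h; rewrite -!EFinD !lee_fin; lra.
  by rewrite leey.
have := mS _ _ _ _ Sx0 (fS (x, x' + x0') fx).
by rewrite pairingBr pairingDr; lra.
Qed.

Theorem theorem2p2 (R : realType) (X : completeNormedModType R)
    (T : X -> set (dual X)) :
  (exists s : X -> \bar R,
     [/\ avoids_ninfty s, lower_semicontinuous s, proper_fun s, sublinear s
       & T = subdifferential s])
  <->
  (maximally_monotone T /\ op_range T = T 0).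
Proof.
split=> [[s [ns ls ps ss ->]]|[mT rT]].
  split; last exact: range_subdifferential_sublinear.
  by apply: subdifferential_maximally_monotone => //; exact: ss.1.
have [TE T0] := maximally_monotone_support_fun mT rT.
exists (support_fun (T 0)); split=> //.
- exact: support_fun_avoids_ninfty.
- exact: support_fun_lsc.
- by exists 0; rewrite support_fun0.
- exact: support_fun_sublinear.
Qed.
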